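(* Let $k\geq 3$ be an integer and let $G$ be a connected graph of order $n\geq k^2$. If the minimum degree satisfies $\delta(G)\geq \frac{n-k+1}{k}$, then $G$ has at most $k-2$ cut edges.
   Context: All graphs are finite, simple and undirected; a cut edge is an edge whose removal disconnects the graph. *)

(* Defs.v *)
From HB Require Import structures.
From mathcomp Require Import all_boot all_order all_algebra.

Set Implicit Arguments.
Unset Strict Implicit.
Unset Printing Implicit Defensive.

Record sgraph := SGraph {
  vertex :> finType;
  adj : rel vertex;
  adj_sym : symmetric adj;
  adj_irrefl : irreflexive adj
}.

Definition edges (G : sgraph) : {set {set G}} :=
  [set E : {set G} | [exists x, exists y, adj x y && (E == [set x; y])]].

Definition degree (G : sgraph) (x : G) : nat := #|[set y | adj x y]|.

(* The default value #|G| exceeds every degree, so it matters only for the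
   graph without vertices. *)
Definition min_degree (G : sgraph) : nat := \big[minn/#|G|]_(x : G) degree x.

Definition connected (G : sgraph) : bool :=
  (0 < #|G|) && [forall x : G, forall y : G, connect (@adj G) x y].

Section DeleteEdge.
Variables (G : sgraph) (E : {set G}).

Definition del_adj : rel G := [rel x y | adj x y && ([set x; y] != E)].

Lemma del_adj_sym : symmetric del_adj.
Proof. by move=> x y; rewrite /del_adj /= adj_sym setUC. Qed.

Lemma del_adj_irrefl : irreflexive del_adj.
Proof. by move=> x; rewrite /del_adj /= adj_irrefl. Qed.

Definition del_edge : sgraph := SGraph del_adj_sym del_adj_irrefl.

End DeleteEdge.

Definition cut_edges (G : sgraph) : {set {set G}} :=
  [set E in edges G | ~~ connected (del_edge E)].

(* Main.v *)
Require Import Defs.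
From HB Require Import structures.
From mathcomp Require Import all_boot all_order all_algebra.
From mathcomp Require Import zify.

Set Implicit Arguments.
Unset Strict Implicit.
Unset Printing Implicit Defensive.

Import Order.TTheory GRing.Theory Num.Theory.

(** The hypotheses say that [k (delta + 1) > n] and force [delta >= k].  If
    there were [k - 1] cut edges, delete exactly [k - 1] of them: at least [k]
    components remain.  A component with at most [delta] vertices would have at
    least [delta] edges leaving it, more than were deleted; so every component
    has at least [delta + 1] vertices and [n >= k (delta + 1)], a
    contradiction. *)

Section DeleteEdges.
Variable G : sgraph.
Implicit Types (F : {set {set G}}) (E : {set G}) (S : {set G}) (x y : G).

Definition del_set F : rel G := [rel x y | adj x y && ([set x; y] \notin F)].

Lemma del_set_connect_sym F : connect_sym (del_set F).
Proof.
by apply: sym_connect_sym => x y; rewrite /del_set /= adj_sym setUC.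
Qed.

Lemma connect_del_setS F F' : F \subset F' ->
  subrel (connect (del_set F')) (connect (del_set F)).
Proof.
move=> sFF'; apply: connect_sub => x y /andP[xy nF]; apply: connect1.
by rewrite /del_set /= xy (contra (subsetP sFF' _)).
Qed.

Lemma min_degree_le x : min_degree G <= degree x.
Proof.
rewrite /min_degree; have: x \in index_enum G by rewrite mem_index_enum.
elim: (index_enum G) => //= y r IHr; rewrite inE big_cons.
case/orP=> [/eqP->|/IHr xr]; first exact: geq_minl.
exact: leq_trans (geq_minr _ _) xr.
Qed.

(** If the ends of [E] stayed linked without [F], they would be linked without [E] alone; detouring
    every use of [E] would then keep the graph connected. *)
Lemma cut_edge_disconnects E F : connected G -> E \in cut_edges G -> E \in F ->
  exists x y, [/\ adj x y, E = [set x; y] & ~~ connect (del_set F) x y].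
Proof.
case/andP=> G0 /forallP/(_ _)/forallP cG; rewrite !inE => /andP[].
case/existsP=> x /existsP[y /andP[xy /eqP EE]] ncE EF; exists x, y; split=> //.
apply: contra ncE => cxy; rewrite /connected G0 /=.
apply/forallP=> u; apply/forallP=> v.
have cxyE : connect (del_set [set E]) x y.
  by apply: connect_del_setS cxy; rewrite sub1set.
have delE : del_set [set E] =2 del_adj E by move=> a b; rewrite /del_set /= inE.
rewrite -(eq_connect delE).
apply: connect_sub (cG u v) => a b ab.
have [abE|nabE] := eqVneq [set a; b] E; last first.
  by apply: connect1; rewrite /del_set /= ab inE.
have cyxE : connect (del_set [set E]) y x by rewrite del_set_connect_sym.
have : a \in [set x; y] by rewrite -EE -abE set21.
have : b \in [set x; y] by rewrite -EE -abE set22.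
by rewrite !inE => /orP[]/eqP-> /orP[]/eqP->.
Qed.

(** A partial transversal of the components left by deleting [F]: its size bounds their number from
    below. *)
Definition separated F S :=
  {in S &, forall x y, connect (del_set F) x y -> x = y}.

(* Deleting one more cut edge [xy] splits the component of [x]: the transversal
   is extended by an endpoint that is cut off from its old representative. *)
Lemma separated_cut_edges F : connected G -> F \subset cut_edges G ->
  exists2 S : {set G}, #|S| = #|F|.+1 & separated F S.
Proof.
move=> cG; have [m] := ubnP #|F|; elim: m F => // m IHm F ltFm sF.
have [->|[E EF]] := set_0Vmem F.
  case/andP: cG => /card_gt0P[x _] _; exists [set x].
    by rewrite cards1 cards0.
  by move=> a b; rewrite !inE => /eqP-> /eqP->.
have cF := cardsD1 E F; rewrite EF add1n in cF.
have sF' : F :\ E \subset F by exact: subsetDl.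
have [||S cS sepS] := IHm (F :\ E); first by rewrite cF in ltFm.
  exact: subset_trans sF' sF.
have [x [y [xy EE nxy]]] := cut_edge_disconnects cG (subsetP sF _ EF) EF.
have sub := connect_del_setS sF'.
have cxy : connect (del_set (F :\ E)) x y.
  by apply: connect1; rewrite /del_set /= xy !inE EE eqxx.
suff [z zP] : exists z, {in S, forall s, ~~ connect (del_set F) s z}.
  have zS : z \notin S by apply/negP=> /zP; rewrite connect0.
  exists (z |: S); first by rewrite cardsU1 zS cS cF.
  move=> a b; rewrite !inE => /orP[/eqP->|aS] /orP[/eqP->|bS] //.
  - by rewrite del_set_connect_sym (negPf (zP _ bS)).
  - by rewrite (negPf (zP _ aS)).
  - by move/sub; apply: sepS.
have [/existsP[s /andP[sS sx]]|] :=
    boolP [exists s, (s \in S) && connect (del_set (F :\ E)) s x]; last first.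
  rewrite negb_exists => /forallP nS; exists x => s sS.
  by have := nS s; rewrite sS; apply: contra => /sub.
(* Inside the old component of [x], only its representative [s] can still reach a given vertex. *)
have onlys t z : t \in S -> connect (del_set (F :\ E)) x z ->
    connect (del_set F) t z -> t = s.
  move=> tS xz /sub tz; apply: sepS => //.
  rewrite del_set_connect_sym in tz; rewrite del_set_connect_sym.
  exact: connect_trans (connect_trans sx xz) tz.
(* As [x] and [y] are now separated, [s] misses at least one of them; that one is the new vertex. *)
have [sxF|nsx] := boolP (connect (del_set F) s x).
  exists y => t tS; apply/negP=> ty; have ts := onlys _ _ tS cxy ty.
  rewrite {}ts in ty; case/negP: nxy; rewrite del_set_connect_sym in sxF.
  exact: connect_trans sxF ty.
exists x => t tS; apply/negP=> tx.
have ts := onlys _ _ tS (connect0 _ _) tx.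
by rewrite ts (negPf nsx) in tx.
Qed.

(* Each neighbour [y] of [x] yields its own edge leaving the component: [xy] if
   [y] is outside, and an edge at [y] otherwise (one exists because the
   component is too small to contain all neighbours of [y]). *)
Lemma component_card F x : #|F| < min_degree G ->
  min_degree G < #|[set v | connect (del_set F) x v]|.
Proof.
move=> ltF; set C := [set _ | _]; rewrite ltnNge; apply: contraL ltF => leC.
rewrite -leqNgt.
have xC : x \in C by rewrite inE connect0.
have out y : y \in C -> exists z, adj y z && (z \notin C).
  move=> yC; apply/existsP; apply/contraT=> /existsPn inC.
  (* With all its neighbours in [C], [y] would have degree at most [#|C| - 1], below the minimum
     degree. *)
  have sub : [set z | adj y z] \subset C :\ y.
    apply/subsetP=> z; rewrite inE => yz; rewrite in_setD1.
    have := inC z; rewrite yz negbK => ->; rewrite andbT.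
    by apply: contraTneq yz => ->; rewrite adj_irrefl.
  have := subset_leq_card sub; have := min_degree_le y.
  by rewrite /degree; have := cardsD1 y C; rewrite yC; lia.
have inF y z : y \in C -> adj y z -> z \notin C -> [set y; z] \in F.
  rewrite !inE => xy yz; apply: contraR => yzF.
  by apply: connect_trans xy (connect1 _); rewrite /del_set /= yz.
pose w y := odflt y [pick z | adj y z && (z \notin C)].
have wP y : y \in C -> adj y (w y) /\ w y \notin C.
  move=> /out[z yz]; rewrite /w; case: pickP => [t /andP[] //|/(_ z)].
  by rewrite yz.
pose f y := if y \in C then [set y; w y] else [set x; y].
apply: leq_trans (min_degree_le x) _; rewrite /degree.
rewrite -(card_in_imset (f := f)).
  apply/subset_leq_card/subsetP=> _ /imsetP[y xy ->]; rewrite inE in xy.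
  rewrite /f; case: ifPn => [yC|]; last exact: inF.
  by have [ay wC] := wP _ yC; apply: inF.
have nxN y : adj x y -> y != x.
  by apply: contraTneq => ->; rewrite adj_irrefl.
move=> a b; rewrite !inE => xa xb; rewrite /f.
(* Injectivity of [f]: equal edges share their vertices, while [w] takes values outside [C] and
   neither [a] nor [b] is [x]. *)
case: ifPn => aC; case: ifPn => bC /setP eqf.
- have := eqf a; rewrite !inE eqxx /= => /esym/orP[/eqP//|/eqP aw].
  by have [_] := wP _ bC; rewrite -aw aC.
- have := eqf a; rewrite !inE eqxx (negPf (nxN _ xa)) /= => /esym/eqP ab.
  by rewrite -ab aC in bC.
- have := eqf b; rewrite !inE eqxx (negPf (nxN _ xb)) /= => /eqP ba.
  by rewrite -ba bC in aC.
- have := eqf a; rewrite !inE eqxx (negPf (nxN _ xa)) orbT /=.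
  by move/esym/eqP.
Qed.

(** Double counting: a vertex lies in the component of at most one member of [S]. *)
Lemma sum_component_card F S : separated F S ->
  \sum_(s in S) #|[set v | connect (del_set F) s v]| <= #|G|.
Proof.
move=> sepS; under eq_bigr => s _ do rewrite -sum1_card.
rewrite (exchange_big_dep predT) //= -sum1_card; apply: leq_sum => v _.
rewrite sum1_card; apply/card_le1_eqP => s t /andP[sS]; rewrite inE => sv /andP[tS]; rewrite inE => tv.
apply: sepS => //.
by apply: connect_trans tv _; rewrite del_set_connect_sym.
Qed.

Lemma cut_edges_card_bound F : connected G -> F \subset cut_edges G ->
  #|F| < min_degree G -> #|F|.+1 * (min_degree G).+1 <= #|G|.
Proof.
move=> cG sF ltF; have [S <- sepS] := separated_cut_edges cG sF.
apply: leq_trans (sum_component_card sepS).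
by rewrite -sum_nat_const; apply: leq_sum => s _; apply: component_card.
Qed.

End DeleteEdges.

Theorem theorem3p1 (k : nat) (G : sgraph) (n : nat) :
  3 <= k ->
  connected G ->
  #|G| = n ->
  k ^ 2 <= n ->
  ((n%:R - k%:R + 1) / k%:R <= (min_degree G)%:R :> rat)%R ->
  #|cut_edges G| <= k - 2.
Proof.
move=> k3 cG cardG k2n.
rewrite ler_pdivrMr ?ltr0n; last by lia.
rewrite addrAC lerBlDr natr1 -natrM -natrD ler_nat => degG.
(* Otherwise [k * (min_degree G).+1 <= k ^ 2 <= n], against [degG]. *)
have kd : k <= min_degree G.
  rewrite -mulnn in k2n; rewrite leqNgt; apply/negP=> dk.
  by have := leq_mul2r k (min_degree G).+1 k; rewrite dk orbT mulSn; lia.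
rewrite leqNgt; apply/negP=> gt.
(* Exactly [k.-1] cut edges are chosen, so that [kd] puts their number below the minimum degree. *)
have : 0 < #|[set F : {set {set G}} | F \subset cut_edges G & #|F| == k.-1]|.
  by rewrite cards_draws bin_gt0; lia.
case/card_gt0P=> F; rewrite inE => /andP[sF /eqP cF].
have := cut_edges_card_bound cG sF; rewrite cF cardG prednK; last by lia.
by move=> /(_ _); rewrite mulnS mulnC; lia.
Qed.
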